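(* Let $p$ be a prime. If $G=D_{2p}$, then $M_1(\mathcal{B}(G))=10p^4-18p^3+11p^2+9p+2$ and $M_2(\mathcal{B}(G))=10p^4-18p^3+7p^2+9p+2$. Further, $\frac{M_{2}(\mathcal{B}(G))}{|e(\mathcal{B}(G))|} \geq \frac{M_{1}(\mathcal{B}(G))}{|V(\mathcal{B}(G))|}$.
   Context: $D_{2n}=\langle a,b : a^n=b^2=1,\ bab=a^{-1}\rangle$ is the dihedral group of order $2n$. For a finite group $G$, $L(G)$ denotes the set of all subgroups of $G$. The subgroup generating bipartite graph $\mathcal{B}(G)$ is the simple undirected bipartite graph whose vertex set is the disjoint union $(G\times G)\sqcup L(G)$, where $(x,y)\in G\times G$ and $H\in L(G)$ are adjacent if and only if $H=\langle x,y\rangle$ (the subgroup generated by $x$ and $y$); there are no other edges. For a finite simple graph $\mathcal{G}$ with vertex set $V(\mathcal{G})$ and edge set $e(\mathcal{G})$, the first and second Zagreb indices are $M_1(\mathcal{G})=\sum_{v\in V(\mathcal{G})}\deg(v)^2$ and $M_2(\mathcal{G})=\sum_{uv\in e(\mathcal{G})}\deg(u)\deg(v)$. *)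

(* Defs.v *)
From HB Require Import structures.
From mathcomp Require Import all_boot all_order all_algebra.
From mathcomp Require Import all_fingroup.

Set Implicit Arguments.
Unset Strict Implicit.
Unset Printing Implicit Defensive.

Local Open Scope group_scope.

Record sgraph := SGraph {
  vertex : finType;
  adj : rel vertex;
  adj_sym : symmetric adj;
  adj_irr : irreflexive adj }.

Definition edges (g : sgraph) : {set {set vertex g}} :=
  [set [set e.1; e.2] | e : vertex g * vertex g & adj e.1 e.2].

Definition deg (g : sgraph) (v : vertex g) : nat := #|[set w | adj v w]|.

Definition zagreb1 (g : sgraph) : nat := (\sum_(v : vertex g) deg v ^ 2)%N.

(* An edge is the two-element set of its (distinct) endpoints, so the product
   over e = {u, v} is deg u * deg v, and every edge is counted once. *)
Definition zagreb2 (g : sgraph) : nat :=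
  (\sum_(e in edges g) \prod_(v in e) deg v)%N.

Section SubgroupGeneratingBipartiteGraph.

(* The finite group is the whole type gT, so that {group gT} is the set of all
   its subgroups. *)
Variable gT : finGroupType.

Definition sgb_adj (u v : (gT * gT) + {group gT}) : bool :=
  match u, v with
  | inl (x, y), inr H | inr H, inl (x, y) => H == <<[set x; y]>>%G
  | _, _ => false
  end.

Lemma sgb_adj_sym : symmetric sgb_adj.
Proof. by move=> [[x y]|H] [[x' y']|K]. Qed.

Lemma sgb_adj_irr : irreflexive sgb_adj.
Proof. by move=> [[x y]|H]. Qed.

Definition sgb_graph : sgraph := SGraph sgb_adj_sym sgb_adj_irr.

End SubgroupGeneratingBipartiteGraph.

(* gT is D_{2n}, of order 2n. "\isog Grp" is the universal property of the
   presentation among finite groups; for n > 0 the presented group is finite,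
   so this says that gT is isomorphic to it. *)
Definition is_dihedral (n : nat) (gT : finGroupType) : Prop :=
  [set: gT] \isog Grp (a : b : a ^+ n = b ^+ 2 = 1, b * a * b = a^-1).

(* Main.v *)
Require Import Defs.
From mathcomp Require Import all_boot all_order all_algebra all_fingroup.
From mathcomp Require Import cyclic extremal zify ring.

Import GRing.Theory Num.Theory.
Local Open Scope ring_scope.

(** Call [d H] the number of pairs [(x, y)] that generate [H].  In the graph
    every pair has degree one, its only neighbour being the subgroup that it
    generates, and a subgroup [H] has degree [d H].  Hence edges correspond to
    pairs, an edge below [H] contributes [1 * d H] to the second Zagreb index,
    and
      [M2 = \sum_H d H ^ 2],  [M1 = #|G| ^ 2 + M2],
      [|e| = #|G| ^ 2],        [|V| = #|G| ^ 2 + #|L(G)|].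

    Since the [d H] add up to [#|G| ^ 2], the Cauchy-Schwarz inequality says
    [#|G| ^ 4 <= #|L(G)| * M2]; after clearing denominators this is exactly
    [M1 / |V| <= M2 / |e|], which therefore holds for every finite group
    ([zagreb_mean_leq]).

    For the two values, what matters about the dihedral group of order [2 * p]
    is that it has a subgroup [A] of prime order [p] and index two outside which
    every element squares to 1.  Its subgroups are then the trivial one, [A],
    the whole group and one subgroup of order two for each of the [p] elements
    outside [A] ([sum_over_subgroups]); for [p = 2] this is still correct,
    although [A] also has order two.  A group of prime order is generated by
    every pair except [(1, 1)], so [d] is 1, [p ^ 2 - 1] and [p] times 3 on the
    proper subgroups, and the whole group takes the
    [4 * p ^ 2 - 1 - (p ^ 2 - 1) - 3 * p = 3 * (p ^ 2 - p)] remaining pairs. *)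

(** * Degrees and Zagreb indices of the subgroup generating graph *)

Section SubgroupGeneratingGraph.
Local Open Scope nat_scope.
Local Open Scope group_scope.

Variable gT : finGroupType.
Implicit Types (H Q : {group gT}) (u : gT * gT).

Definition pair_span u : {group gT} := <<[set u.1; u.2]>>%G.

Definition generating_pairs H : {set gT * gT} := [set u | pair_span u == H].

Lemma deg_pair u : deg (g := sgb_graph gT) (inl u) = 1%N.
Proof.
case: u => x y; apply/eqP/cards1P; exists (inr (pair_span (x, y))).
by apply/setP=> -[[x' y']|H]; rewrite !inE.
Qed.

Lemma deg_subgroup H :
  deg (g := sgb_graph gT) (inr H) = #|generating_pairs H|.
Proof.
rewrite /deg -(card_imset _ (@inl_inj (gT * gT)%type {group gT})).
apply: eq_card => -[[x y]|K]; rewrite !inE /=.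
  by rewrite (mem_imset _ _ (@inl_inj _ _)) inE eq_sym.
by symmetry; apply/imsetP=> -[].
Qed.

(** Double counting: grouping the pairs by the subgroup that they generate
    turns a sum over edges into a sum over subgroups. *)
Lemma sum_over_pairs (F : {group gT} -> nat) :
  (\sum_(u : gT * gT) F (pair_span u) = \sum_H #|generating_pairs H| * F H)%N.
Proof.
rewrite (partition_big pair_span xpredT) //=; apply: eq_bigr => H _.
rewrite (eq_bigr (fun=> F H)) => [|u /eqP-> //].
by rewrite sum_nat_const; congr (_ * _)%N; apply: eq_card => u; rewrite !inE.
Qed.

Lemma sum_generating_pairs :
  (\sum_H #|generating_pairs H| = #|gT| ^ 2)%N.
Proof.
rewrite -(eq_bigr _ (fun H _ => muln1 _)) -(sum_over_pairs (fun=> 1%N)).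
by rewrite sum1_card card_prod.
Qed.

Definition pair_edge u : {set vertex (sgb_graph gT)} :=
  [set inl u; inr (pair_span u)].

Lemma pair_edge_inj : injective pair_edge.
Proof.
move=> u v /setP/(_ (inl u)); rewrite !inE eqxx /=.
by move/esym/orP=> [/eqP[]|/eqP].
Qed.

Lemma edges_sgb : edges (sgb_graph gT) = pair_edge @: setT.
Proof.
apply/setP=> e; apply/imsetP/imsetP=> [[[]]|[[x y] _ ->]]; last first.
  by exists (inl (x, y), inr (pair_span (x, y))); rewrite // inE /= eqxx.
move=> [[x y]|H] [[x' y']|K] //=; rewrite inE //= => /eqP-> ->.
  by exists (x, y).
by exists (x', y'); rewrite // /pair_edge setUC.
Qed.

Lemma card_edges_sgb : #|edges (sgb_graph gT)| = (#|gT| ^ 2)%N.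
Proof.
by rewrite edges_sgb (card_imset _ pair_edge_inj) cardsT card_prod.
Qed.

Lemma card_vertex_sgb :
  #|vertex (sgb_graph gT)| = (#|gT| ^ 2 + #|{group gT}|)%N.
Proof. by rewrite card_sum card_prod. Qed.

Lemma zagreb1_sgb :
  zagreb1 (sgb_graph gT) =
    (#|gT| ^ 2 + \sum_H #|generating_pairs H| ^ 2)%N.
Proof.
rewrite /zagreb1 big_sumType /=; congr (_ + _)%N; last first.
  by apply: eq_bigr => H _; rewrite deg_subgroup.
rewrite (eq_bigr (fun=> 1%N)) => [|u _]; last by rewrite deg_pair.
by rewrite sum1_card card_prod.
Qed.

Lemma zagreb2_sgb :
  zagreb2 (sgb_graph gT) = (\sum_H #|generating_pairs H| ^ 2)%N.
Proof.
rewrite /zagreb2 edges_sgb big_imset => [|u v _ _ /pair_edge_inj //].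
rewrite -[RHS](sum_over_pairs (fun H => #|generating_pairs H|)).
rewrite big_mkcond /=; apply: eq_bigr => u _; rewrite inE.
by rewrite big_setU1 ?inE //= big_set1 deg_pair deg_subgroup mul1n.
Qed.

(** Cauchy-Schwarz against the constant family, obtained by summing
    [2 * d i * d j <= d i ^ 2 + d j ^ 2] over all [i] and [j]. *)
Lemma sqr_sum_leq (I : finType) (d : I -> nat) :
  ((\sum_i d i) ^ 2 <= #|I| * \sum_i d i ^ 2)%N.
Proof.
rewrite -(leq_pmul2l (ltn0Sn 1)) expnS expn1 big_distrlr big_distrr /=.
have -> : (2 * (#|I| * \sum_i d i ^ 2) =
    \sum_i \sum_j (d i ^ 2 + d j ^ 2))%N.
  transitivity (\sum_i (#|I| * d i ^ 2 + \sum_j d j ^ 2))%N.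
    by rewrite big_split /= sum_nat_const -big_distrr mul2n addnn.
  by apply: eq_bigr => i _; rewrite big_split /= sum_nat_const.
apply: leq_sum => i _; rewrite big_distrr /=.
by apply: leq_sum => j _; apply: (nat_Cauchy _ _).
Qed.

(** With [N = #|G| ^ 2] and [L = #|L(G)|] the claim is
    [(N + M2) / (N + L) <= M2 / N].  Both cross products contain [M2 * N], and
    what remains, [N ^ 2 <= L * M2], is Cauchy-Schwarz for the degrees of the
    subgroups, whose sum is [N]. *)
Lemma zagreb_mean_leq :
  ((zagreb1 (sgb_graph gT))%:R / #|vertex (sgb_graph gT)|%:R
    <= (zagreb2 (sgb_graph gT))%:R / #|edges (sgb_graph gT)|%:R :> rat)%R.
Proof.
have gT0 : (0 < #|gT| ^ 2)%N by rewrite expn_gt0 -cardsT cardG_gt0.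
rewrite zagreb1_sgb zagreb2_sgb card_vertex_sgb card_edges_sgb.
have := sqr_sum_leq _ (fun H => #|generating_pairs H|).
rewrite sum_generating_pairs; move: gT0.
move: (#|gT| ^ 2)%N (\sum_H _)%N #|{group gT}| => N M L N0 cs.
rewrite ler_pdivrMr ?ltr0n ?addn_gt0 ?N0 // mulrAC ler_pdivlMr ?ltr0n //.
by rewrite -!natrM ler_nat; nia.
Qed.

(** * Pairs generating a trivial or prime order group *)

Lemma pair_span_sub u H : (pair_span u \subset H) = (u.1 \in H) && (u.2 \in H).
Proof. by rewrite gen_subG subUset !sub1set. Qed.

Lemma generating_pairs_trivial : #|generating_pairs 1%G| = 1%N.
Proof.
apply/eqP/cards1P; exists (1, 1); apply/setP=> -[x y]; rewrite !inE.
rewrite -val_eqE /= eqEsubset sub1G andbT.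
by rewrite (pair_span_sub (x, y) 1%G) !inE xpair_eqE.
Qed.

(** A group of prime order has no proper nontrivial subgroup, so a pair of its
    elements fails to generate it only when both are trivial. *)
Lemma generating_pairs_prime Q :
  prime #|Q| -> #|generating_pairs Q| = (#|Q| ^ 2 - 1)%N.
Proof.
move=> prQ; have -> : generating_pairs Q = setX Q Q :\ (1, 1).
  apply/setP=> -[x y]; rewrite !inE /=; apply/eqP/idP => [eqQ|].
    have: pair_span (x, y) \subset Q by rewrite eqQ.
    rewrite pair_span_sub => ->; rewrite andbT; apply/eqP=> -[x1 y1].
    have: pair_span (x, y) \subset 1%G by rewrite pair_span_sub x1 y1 !inE eqxx.
    by rewrite eqQ => /subset_leq_card; rewrite cards1 leqNgt prime_gt1.
  case/andP=> n1 inQ; apply/eqP; rewrite -val_eqE /= eqEsubset.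
  rewrite (pair_span_sub (x, y)) inQ /= -[Q \subset _]negbK; apply/negP=> nsub.
  have: pair_span (x, y) \subset [1 gT].
    rewrite -(prime_TIg prQ nsub) subsetI subxx andbT.
    by rewrite (pair_span_sub (x, y)).
  by rewrite (pair_span_sub (x, y) 1%G) !inE; apply/negP.
rewrite expnS expn1 -cardsX (cardsD1 (1, 1) (setX Q Q)).
by rewrite !inE !group1 addKn.
Qed.

(** * Groups of involutions outside a prime order subgroup of index two *)

Section ReflectionsOverPrimeSubgroup.
Variable A : {group gT}.
Hypotheses (prA : prime #|A|) (oG : #|gT| = (2 * #|A|)%N)
  (invA : forall r : gT, r \notin A -> r ^+ 2 = 1).

Lemma order_outside {r} : r \notin A -> #[r] = 2.
Proof.
move=> Ar; apply: nt_prime_order => //; first exact: invA.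
by apply: contraNneq Ar => ->.
Qed.

Lemma card_outside : #|~: A| = #|A|.
Proof. by rewrite cardsCs setCK oG; lia. Qed.

(** The index of [A] is two, which leaves no room between [A] and the group. *)
Lemma proper_over_full {H} : A \subset H -> H != A -> H = [set: gT]%G.
Proof.
move=> sAH neHA; apply/val_inj/eqP; rewrite /= eqEcard subsetT /=.
have ltAH : (#|A| < #|H|)%N.
  by apply: proper_card; rewrite properEneq sAH andbT eq_sym.
have := cardSg (subsetT H); have /dvdnP[k eqk] := cardSg sAH.
rewrite cardsT oG eqk dvdn_pmul2r ?leq_pmul2r ?prime_gt0 //.
by move=> /dvdn_leq; rewrite eqk in ltAH; nia.
Qed.

(** As [A] has prime order it meets [H] trivially, so [A * H] has [#|A| * #|H|]
    elements; this is at most [2 * #|A|], hence [H] has order two. *)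
Lemma outside_subgroupE {H} :
  ~~ (H \subset A) -> ~~ (A \subset H) -> exists2 r, r \notin A & H = <[r]>%G.
Proof.
case/subsetPn=> r Hr Ar nAH; exists r => //; apply/val_inj/eqP.
rewrite /= eq_sym eqEcard cycle_subG Hr -[#|<[r]>|]/#[r] (order_outside Ar) /=.
have := subset_leq_card (subsetT (A * H)).
rewrite (TI_cardMg (prime_TIg prA nAH)) cardsT oG mulnC.
by rewrite leq_pmul2r ?prime_gt0.
Qed.

(** A group of order two determines its nontrivial element. *)
Lemma cycle_outside_inj : {in ~: A &, injective (fun r => <[r]>%G)}.
Proof.
move=> r s; rewrite !inE => Ar As /(congr1 val)/= eq_rs.
have: s \in <[r]> by rewrite eq_rs cycle_id.
have r2 := order_outside Ar.
by rewrite (cycle2g r2) !inE => /orP[]/eqP eqs; rewrite eqs // group1 in As.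
Qed.

Lemma sum_over_subgroups (F : {group gT} -> nat) :
  (\sum_H F H = F 1%G + F A + F [set: gT]%G + \sum_(r in ~: A) F <[r]>%G)%N.
Proof.
have oA1 := prime_gt1 prA.
have neq_card (H K : {group gT}) : #|H| <> #|K| -> H != K.
  by apply: contra_not_neq => ->.
have A1 : A != 1%G by apply: neq_card; rewrite cards1; lia.
have AT : [set: gT]%G != A by apply: neq_card; rewrite cardsT oG; lia.
have T1 : [set: gT]%G != 1%G.
  by apply: neq_card; rewrite cardsT oG cards1; lia.
rewrite (bigD1 1%G) //= (bigD1 A) //= (bigD1 [set: gT]%G) ?T1 //= !addnA.
congr (_ + _)%N.
rewrite -(big_imset _ cycle_outside_inj) /=; apply: eq_bigl => H.
apply/idP/imsetP=> [/andP[/andP[H1 HA] HT] | [r]].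
  have [||r Ar ->] := outside_subgroupE (H := H); last by exists r; rewrite ?inE.
    apply/negP=> sHA.
    case/boolP: (A \subset H) => [sAH|/(prime_TIg prA)].
      by case/negP: HA; rewrite -val_eqE /= eqEsubset sHA.
    rewrite (setIidPr sHA) => /(@group_inj _ H 1%G) eqH1.
    by rewrite eqH1 eqxx in H1.
  by apply: contra HT => sAH; apply/eqP; apply: proper_over_full.
rewrite inE => Ar ->; have or := order_outside Ar.
have nsrA : ~~ (<[r]> \subset A) by rewrite cycle_subG.
rewrite -andbA; apply/and3P; split.
- by apply: contraNneq nsrA => /(congr1 val)/= ->; exact: sub1G.
- by apply: contraNneq nsrA => /(congr1 val)/= ->.
apply: neq_card; rewrite cardsT oG -[#|<[r]>%G|]/#[r] or; lia.
Qed.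

Lemma generating_pairs_outside r :
  r \notin A -> #|generating_pairs <[r]>%G| = 3.
Proof.
move=> Ar; rewrite generating_pairs_prime -[#|<[r]>%G|]/#[r];
  by rewrite order_outside.
Qed.

(** The number of pairs generating the whole group is not computed directly: it
    is what the total number of pairs leaves over after all proper subgroups. *)
Lemma sum_sqr_generating_pairs :
  (\sum_H #|generating_pairs H| ^ 2
    = 1 + (#|A| ^ 2 - 1) ^ 2 + (3 * (#|A| ^ 2 - #|A|)) ^ 2 + 9 * #|A|)%N.
Proof.
have sum_out (f : gT -> nat) c : (forall r, r \notin A -> f r = c) ->
    (\sum_(r in ~: A) f r = c * #|A|)%N.
  move=> Fc; rewrite (eq_bigr (fun=> c)) => [|r]; last by rewrite inE; apply: Fc.
  by rewrite sum_nat_const card_outside mulnC.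
have := sum_generating_pairs; rewrite !sum_over_subgroups.
rewrite (sum_out _ 3) => [|r]; last exact: generating_pairs_outside.
rewrite (sum_out _ 9) => [|r /generating_pairs_outside-> //].
rewrite generating_pairs_trivial generating_pairs_prime // oG.
set g := #|generating_pairs [set: gT]%G|; have := prime_gt1 prA; set p := #|A|.
(* Comparing with the total number of pairs identifies g. *)
move=> p1 eqg; congr (_ + _ ^ 2 + _)%N.
have: (p <= p ^ 2 /\ 1 <= p ^ 2)%N by nia.
lia.
Qed.

End ReflectionsOverPrimeSubgroup.

(** * The dihedral presentation *)

Lemma involution_conjE (rT : finGroupType) (a b : rT) :
  b ^+ 2 = 1 -> b * a * b = a ^ b.
Proof.
move=> b2; rewrite conjgE -mulgA; congr (_ * _).
by apply/esym/eqP; rewrite eq_invg_mul -b2.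
Qed.

(** For an involution [b] the relation [b * a * b = a^-1] says that [b] inverts
    [a] by conjugation, which is the form of the presentation satisfied by the
    concrete dihedral group ['D_(p.*2)].  The group and this model are thus
    homomorphic images of each other, which fixes the order of the group. *)
Lemma dihedral_homg (p : nat) :
  (1 < p)%N -> is_dihedral p gT ->
  forall (rT : finGroupType) (H : {group rT}),
    (H \homg [set: gT]) = (H \homg [set: 'D_(p.*2)]).
Proof.
move=> p1 dihG rT H.
rewrite dihG Grp_dihedral //; apply: eq_existsb => -[a b] /=.
rewrite !xpair_eqE /=; case: (b ^+ 2 =P 1) => [b2|_]; last by rewrite !andbF.
by rewrite involution_conjE.
Qed.

(** The subgroup is the one generated by the rotation [a].  It has order [p]
    because [a = 1] would leave a group generated by the involution [b] alone.
    An element outside it is [a ^+ i * b], and [b] inverts [a ^+ i]. *)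
Lemma dihedral_reflections p :
  prime p -> is_dihedral p gT ->
  exists A : {group gT}, [/\ #|A| = p, #|gT| = (2 * p)%N
    & forall r : gT, r \notin A -> r ^+ 2 = 1].
Proof.
move=> prP dihG; have p1 := prime_gt1 prP.
have hom_dih := dihedral_homg p p1 dihG.
have oG : #|gT| = (2 * p)%N.
  apply/eqP; rewrite mul2n -(card_dihedral p1) -cardsT eqn_dvd.
  apply/andP; split; apply: card_homg.
    by rewrite -hom_dih homg_refl.
  by rewrite hom_dih homg_refl.
have := isoGrp_hom dihG; case/existsP=> -[a b] /=; rewrite !xpair_eqE.
move=> /and4P[/eqP G_ab /eqP ap /eqP b2 bab].
have /eqP ab : a ^ b == a^-1 by rewrite -involution_conjE.
have oa : #[a] = p.
  apply: nt_prime_order => //; apply/eqP=> a1.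
  have: (#|gT| <= 2)%N.
    by rewrite -cardsT -G_ab a1 cycle1 joing1G dvdn_leq // order_dvdn b2.
  by rewrite oG; lia.
exists <[a]>%G; split=> // r.
have nab : <[b]> \subset 'N(<[a]>).
  by rewrite cycle_subG; apply/normP; rewrite -cycleJ ab cycleV.
have: r \in <[a]> * <[b]> by rewrite -norm_joinEr // G_ab inE.
case/mulsgP=> _ _ /cycleP[i ->] /cycleP[j ->] ->.
rewrite -(odd_double_half j) expgD -mul2n expgM b2 expg1n mulg1.
(* Only the parity of the exponent of b matters. *)
case: (odd j) => [_|]; last by rewrite mulg1 mem_cycle.
rewrite expg1 expgS expg1 -mulgA [b * _]mulgA involution_conjE //.
by rewrite conjXg ab expgVn mulgV.
Qed.

End SubgroupGeneratingGraph.

Theorem theorem3p6 (p : nat) (gT : finGroupType) :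
  prime p -> is_dihedral p gT ->
  [/\ (zagreb1 (sgb_graph gT))%:Z
        = 10 * p%:Z ^+ 4 - 18 * p%:Z ^+ 3 + 11 * p%:Z ^+ 2 + 9 * p%:Z + 2,
      (zagreb2 (sgb_graph gT))%:Z
        = 10 * p%:Z ^+ 4 - 18 * p%:Z ^+ 3 + 7 * p%:Z ^+ 2 + 9 * p%:Z + 2
    & (zagreb2 (sgb_graph gT))%:R / #|edges (sgb_graph gT)|%:R
        >= (zagreb1 (sgb_graph gT))%:R / #|vertex (sgb_graph gT)|%:R :> rat].
Proof.
move=> prP dihG; have [A [oA oG invA]] := dihedral_reflections _ _ prP dihG.
have prA : prime #|A| by rewrite oA.
have sumE := sum_sqr_generating_pairs _ _ prA.
rewrite oA in sumE; have {}sumE := sumE oG invA.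
have p1 := prime_gt1 prP.
have sumZ : Posz (\sum_H #|generating_pairs gT H| ^ 2)
    = 10 * p%:Z ^+ 4 - 18 * p%:Z ^+ 3 + 7 * p%:Z ^+ 2 + 9 * p%:Z + 2.
  have [p2_gt0 le_p_p2] : (1 <= p ^ 2)%N /\ (p <= p ^ 2)%N by nia.
  by rewrite sumE -!mulnn !(PoszD, PoszM) -!subzn ?mulnn // -mulnn PoszM; ring.
split; [|by rewrite zagreb2_sgb|exact: zagreb_mean_leq].
by rewrite zagreb1_sgb PoszD sumZ oG -mulnn !PoszM; ring.
Qed.
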